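(* Let $\mu_1$ and $\mu_2$ be finite positive Borel measures on the Borel $\sigma$-algebra of a locally compact Hausdorff space $X$. Then $$\mu_1\perp\mu_2\iff \inf(\mu_1,\mu_2)=0.$$
   Context: For a countable family $\{\mu_1,\mu_2,\dots\}$ of finite positive Borel measures on $X$, the infimum $\mu=\inf_k(\mu_k)$ is the positive Borel measure defined by $\mu(E):=\inf\sum_k\mu_k(E_k)$ for each Borel set $E$, where $\mu_k$ runs through the family and the infimum is over all partitions $\{E_1,E_2,\dots\}$ of $E$ into Borel sets; it is the largest positive Borel measure $\mu$ with $\mu\le\mu_k$ for all $k$. For two measures, $\inf(\mu_1,\mu_2)(E)=\inf\{\mu_1(E_1)+\mu_2(E_2)\}$ over Borel partitions $\{E_1,E_2\}$ of $E$. $\mu_1\perp\mu_2$ means mutual singularity: there are disjoint Borel sets $A,B$ with $\mu_1(E)=\mu_1(E\cap A)$ and $\mu_2(E)=\mu_2(E\cap B)$ for every Borel set $E$. *)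

(* Defs.v *)
From HB Require Import structures.
From mathcomp Require Import all_boot all_order all_algebra.
From mathcomp Require Import all_classical all_reals all_analysis.

Set Implicit Arguments.
Unset Strict Implicit.
Unset Printing Implicit Defensive.

Import Order.TTheory GRing.Theory Num.Theory.
Local Open Scope classical_set_scope.
Local Open Scope ring_scope.
Local Open Scope ereal_scope.

(* X is pointed because every measurableType is. *)
Notation borelType X := (g_sigma_algebraType (@open X)).

Definition mutually_singular (d : measure_display) (T : measurableType d)
    (R : realType) (mu1 mu2 : {measure set T -> \bar R}) : Prop :=
  exists A B : set T, [/\ measurable A, measurable B, A `&` B = set0 &
    forall E : set T, measurable E ->
      mu1 E = mu1 (E `&` A) /\ mu2 E = mu2 (E `&` B)].

(* Only meaningful on measurable E; E1 or E2 may be empty. *)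
Definition measure_inf (d : measure_display) (T : measurableType d)
    (R : realType) (mu1 mu2 : {measure set T -> \bar R}) (E : set T) : \bar R :=
  ereal_inf [set x | exists E1 E2 : set T,
    [/\ measurable E1, measurable E2, E1 `|` E2 = E, E1 `&` E2 = set0 &
        x = mu1 E1 + mu2 E2]].

(* Main.v *)
Require Import Defs.
From mathcomp Require Import all_boot all_order all_algebra.
From mathcomp Require Import all_classical all_reals all_analysis.
Import Order.TTheory GRing.Theory Num.Theory.
Local Open Scope classical_set_scope.
Local Open Scope ring_scope.
Local Open Scope ereal_scope.

(** If mu1 lives on A, mu2 lives on B and A, B are disjoint, then cutting a
    set E into its part outside A and its part inside A gives each measure a
    null piece, so the infimum is 0 ([measure_inf_eq0]).

    Conversely, a zero infimum on the whole space provides, for every n, a set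
    F n with mu1 (F n) and mu2 (~` F n) both at most 1 / 2 ^ n.+1. Let S be
    the limit superior of the F n. Both sequences of measures are summable, so
    by the first Borel-Cantelli lemma ([lim_sup_set_cvg0]) mu1 vanishes on S
    and mu2 vanishes on the limit superior of the ~` F n. The latter contains ~` S,
    which is the limit inferior of the same sequence. Hence mu1 lives on ~` S
    and mu2 on S. *)

Lemma measure_setIC_null (d : measure_display) (T : measurableType d)
    (R : realType) (mu : {measure set T -> \bar R}) (N E : set T) :
  measurable N -> measurable E -> mu N = 0 -> mu E = mu (E `&` ~` N).
Proof.
move=> mN mE muN0; rewrite (measureDI mu mE mN) setDE.
rewrite [X in _ + X](@subset_measure0 _ _ _ mu _ N) ?adde0//.
exact: measurableI.
Qed.

(** The left-hand side is the limit inferior of the complements: a point that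
    eventually lies in every ~` F n lies in infinitely many of them. Thanks to
    this, one Borel-Cantelli argument serves both measures. *)
Lemma setC_lim_sup_set_sub (T : Type) (F : (set T)^nat) :
  ~` lim_sup_set F `<=` lim_sup_set (fun n => ~` F n).
Proof.
move=> x /= nx n _; apply: contrapT => nCF; apply: nx => m _.
(* x lies in every F k with k >= n, so k := maxn n m is an index beyond m
   with x in F k. *)
exists (maxn n m); first by rewrite /= leq_maxr.
by apply: contrapT => nF; apply: nCF; exists (maxn n m) => //=;
  rewrite leq_maxl.
Qed.

Lemma lim_sup_set_geometric0 (d : measure_display) (T : measurableType d)
    (R : realType) (mu : {measure set T -> \bar R}) (F : (set T)^nat) :
  (forall n, measurable (F n)) ->
  (forall n, mu (F n) <= (1 / (2 ^ n.+1)%:R)%:E) ->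
  mu (lim_sup_set F) = 0.
Proof.
move=> mF muF; apply: lim_sup_set_cvg0 => //.
apply: le_lt_trans (ltry (1 : R)).
apply: le_trans (epsilon_trick0 xpredT ler01).
by apply: lee_nneseries => n *; [exact: measure_ge0|exact: muF].
Qed.

Lemma measure_inf_setT_lt (d : measure_display) (T : measurableType d)
    (R : realType) (mu1 mu2 : {measure set T -> \bar R}) (e : \bar R) :
  measure_inf mu1 mu2 setT < e ->
  exists F, [/\ measurable F, mu1 F <= e & mu2 (~` F) <= e].
Proof.
move=> /ereal_inf_lt[_ [E1 [E2 [mE1 mE2 E12T E120 ->]]] lte].
have CE1 : ~` E1 = E2.
  by rewrite -setTD -E12T setUKD// E120.
exists E1; split=> //; apply: le_trans (ltW lte).
- by rewrite leeDl.
- by rewrite CE1 leeDr.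
Qed.

Lemma measure_inf_eq0 (d : measure_display) (T : measurableType d)
    (R : realType) (mu1 mu2 : {measure set T -> \bar R}) (E : set T) :
  mutually_singular mu1 mu2 -> measurable E -> measure_inf mu1 mu2 E = 0.
Proof.
move=> [A [B [mA mB AB0 muAB]]] mE.
apply/eqP; rewrite eq_le; apply/andP; split; last first.
  by apply/ereal_infP => _ [E1 [E2 [_ _ _ _ ->]]]; rewrite adde_ge0.
apply: ereal_inf_lbound; exists (E `\` A), (E `&` A).
have mD : measurable (E `\` A) by exact: measurableD.
have mI : measurable (E `&` A) by exact: measurableI.
split=> //; first by rewrite setUC setUIDK.
  by rewrite setDE setIACA setICl !setI0.
rewrite (muAB _ mD).1 (muAB _ mI).2 -setIA AB0 setI0.
by rewrite setDE -setIA setICl setI0 !measure0 adde0.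
Qed.

(** A splitting of the whole space restricts to every E, which is why the
    hypothesis speaks of setT alone. *)
Lemma measure_inf_eq0_singular (d : measure_display) (T : measurableType d)
    (R : realType) (mu1 mu2 : {measure set T -> \bar R}) :
  measure_inf mu1 mu2 setT = 0 -> mutually_singular mu1 mu2.
Proof.
move=> inf0.
have /choice[F /all_and3[mF mu1F mu2F]] (n : nat) : exists F : set T,
    [/\ measurable F, mu1 F <= (1 / (2 ^ n.+1)%:R)%:E &
        mu2 (~` F) <= (1 / (2 ^ n.+1)%:R)%:E].
  by apply: measure_inf_setT_lt; rewrite inf0 lte_fin divr_gt0.
have mlim (G : (set T)^nat) :
    (forall n, measurable (G n)) -> measurable (lim_sup_set G).
  move=> mG; apply: bigcapT_measurable => n.
  exact: bigcup_measurable.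
have mCF n : measurable (~` F n) by exact: measurableC.
have mS := mlim _ mF.
have mCS : measurable (~` lim_sup_set F) by exact: measurableC.
have mu1S : mu1 (lim_sup_set F) = 0 by exact: lim_sup_set_geometric0.
have mu2CS : mu2 (~` lim_sup_set F) = 0.
  apply: (subset_measure0 mCS (mlim _ mCF)).
  - exact: setC_lim_sup_set_sub.
  - exact: lim_sup_set_geometric0.
exists (~` lim_sup_set F), (lim_sup_set F); split=> // [|E mE].
  by rewrite setICl.
split; first exact: measure_setIC_null.
by rewrite -[X in _ `&` X]setCK; exact: measure_setIC_null.
Qed.

Theorem theorem3p3 (R : realType) (X : ptopologicalType)
    (X_hausdorff : hausdorff_space X)
    (X_locally_compact : locally_compact [set: X])
    (mu1 mu2 : {finite_measure set (borelType X) -> \bar R}) :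
  mutually_singular mu1 mu2 <->
  (forall E : set (borelType X), measurable E -> measure_inf mu1 mu2 E = 0).
Proof.
split=> [sing E mE|inf0]; first exact: measure_inf_eq0.
exact/measure_inf_eq0_singular/inf0/measurableT.
Qed.
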